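(* Let $n\ge 1$ be an integer, let $i_1,\dots,i_n$ be independent real random variables with $E(1+i_l)=1+j$ and $Var(1+i_l)=s^2$ for every $l$, where $j\in\mathbb{R}$, $j\ne -1$, and let $1\le k\le n$. Let $p>0$, $q>0$ be real with $q\neq 1+j$, and let $C_k$ be the final value of the annuity-due with annual payments $p,pq,pq^2,\dots,pq^{k-1}$. Then $$Var(C_k)=\frac{2p(1+j)^{k+1}({\ddot s}_g)^{(p,q)}_{\overline{k}|r}-(1+j+q)({\ddot s}_g)^{(p^2,q^2)}_{\overline{k}|f}}{1+j-q}-\frac{p(1+j)\Big(({\ddot s}_g)^{(p,q)}_{\overline{2k}|j}-2q^k({\ddot s}_g)^{(p,q)}_{\overline{k}|j}\Big)}{1+j-q}.$$
   Context: Final value: for annual payments $c_1,c_2,\dots$ the final value is defined by $C_1=(1+i_1)c_1$ and $C_k=(1+i_k)(C_{k-1}+c_k)$ for $k\ge 2$; here $c_l=pq^{l-1}$. For a positive integer $k$ and real $x,a,b$: $({\ddot s}_g)^{(a,b)}_{\overline{k}|x}=\sum_{l=1}^k a\,b^{l-1}(1+x)^{k+1-l}$. Constants: $f=2j+j^2+s^2$ (so $1+f=E[(1+i_l)^2]$), and $r$ is defined by $1+r=(1+f)/(1+j)$. *)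

(* Defs.v *)
From HB Require Import structures.
From mathcomp Require Import all_boot all_order all_algebra.
From mathcomp Require Import finmap.
From mathcomp Require Import all_classical all_reals all_analysis.

Set Implicit Arguments.
Unset Strict Implicit.
Unset Printing Implicit Defensive.

Import Order.TTheory GRing.Theory Num.Theory.
Import numFieldNormedType.Exports.

Local Open Scope classical_set_scope.
Local Open Scope ring_scope.

(* Mutual independence of the subfamily (X l)_{l in A}: the product rule for
   every finite J included in A and all measurable sets B l.  The members of
   the family whose index is outside A are unconstrained. *)
Definition mutually_independent d (T : measurableType d) (R : realType)
    (P : probability T R) (I : choiceType) (A : set I)
    (X : I -> {RV P >-> R}) : Prop :=
  forall (J : {fset I}) (B : I -> set R),
    [set` J] `<=` A ->
    (forall l, l \in J -> measurable (B l)) ->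
    P (\bigcap_(l in [set` J]) (X l @^-1` B l)) =
    (\prod_(l <- J) P (X l @^-1` B l))%E.

(* Years are numbered from 1; the value at k = 0 is a dummy. *)
Fixpoint final_value (R : realType) (i c : nat -> R) (k : nat) : R :=
  match k with
  | 0%N => 0
  | 1%N => (1 + i 1%N) * c 1%N
  | (_.+1 as k').+1 => (1 + i k) * (final_value i c k' + c k)
  end.

(* Final value of an annuity-due whose l-th payment is a * b ^ (l - 1), at
   the constant annual rate x. *)
Definition s_due_geom (R : realType) (a b : R) (k : nat) (x : R) : R :=
  \sum_(1 <= l < k.+1) a * b ^+ (l - 1) * (1 + x) ^+ (k + 1 - l).

(* Main.v *)
(* The final values satisfy C_k = (1 + i_k) (C_{k-1} + c_k).  Since C_{k-1} is
   measurable with respect to sigma(i_1, ..., i_{k-1}), it is independent of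
   i_k, so the first two moments obey
     E C_k   = (1 + j) (E C_{k-1} + c_k),
     E C_k^2 = (1 + f) (E C_{k-1}^2 + 2 c_k E C_{k-1} + c_k^2),
   and for geometric payments both recursions are solved in closed form. *)
Require Import Defs.
From HB Require Import structures.
From mathcomp Require Import all_boot all_order all_algebra.
From mathcomp Require Import finmap.
From mathcomp Require Import all_classical all_reals all_analysis.
From mathcomp Require Import measurable_realfun.
From mathcomp Require Import ring zify.

Import Order.TTheory GRing.Theory Num.Theory.
Import numFieldNormedType.Exports.

Local Open Scope classical_set_scope.
Local Open Scope ring_scope.

(** * Independence of two random variables and the expectation of their product *)

Definition independent_pair {d} {T : measurableType d} {R : realType}
    (P : probability T R) (X Y : T -> R) : Prop :=
  forall A B : set R, measurable A -> measurable B ->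
    P (X @^-1` A `&` Y @^-1` B) = (P (X @^-1` A) * P (Y @^-1` B))%E.

Section independent_pair.
Context {d} {T : measurableType d} {R : realType} (P : probability T R).

Lemma independent_pair_comp (X Y : T -> R) (f g : R -> R) :
    measurable_fun setT f -> measurable_fun setT g ->
  independent_pair P X Y -> independent_pair P (f \o X) (g \o Y).
Proof.
move=> mf mg XY A B mA mB.
have := XY _ _ (mf measurableT _ mA) (mg measurableT _ mB).
by rewrite !setTI.
Qed.

Local Open Scope ereal_scope.

(** Under independence the joint law is the product of the two marginal laws, so Fubini splits the
    integral of [x * y]. *)
Lemma Lfun1_mul_independent (X Y : {RV P >-> R}) :
    independent_pair P X Y ->
    (X : T -> R) \in Lfun P 1 -> (Y : T -> R) \in Lfun P 1 ->
  (X \* Y)%R \in Lfun P 1 /\ 'E_P[(X \* Y)%R] = 'E_P[X] * 'E_P[Y].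
Proof.
move=> XY X1 Y1.
have mX := measurable_funPT X; have mY := measurable_funPT Y.
pose XYw w := (X w, Y w).
have mXY : measurable_fun setT XYw by exact: measurable_fun_pair.
pose h (z : R * R) := (z.1 * z.2)%:E.
have mh : measurable_fun [set: R * R] h.
  by apply/measurable_EFinP; apply: measurable_funM.
pose XYm : {mfun T >-> (R * R)%type} :=
  HB.pack XYw (isMeasurableFun.Build _ _ _ _ XYw mXY).
pose joint : {measure set (R * R) -> \bar R} := distribution P XYm.
pose lX : {sigma_finite_measure set _ -> \bar R} := distribution P X.
pose lY : {sigma_finite_measure set _ -> \bar R} := distribution P Y.
(* Independence is agreement of the two measures on measurable rectangles, and this determines the
   product measure. *)
have jointE A : measurable A -> joint A = (lX \x lY) A.
  move=> mA; apply/esym.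
  by apply: (@product_measure_unique _ _ _ _ _ lX lY joint).
have intX : P.-integrable setT (EFin \o X) by exact/Lfun1_integrable.
have intY : P.-integrable setT (EFin \o Y) by exact/Lfun1_integrable.
have ilX : lX.-integrable setT EFin by exact: integrable_pushforward.
have ilY : lY.-integrable setT EFin by exact: integrable_pushforward.
have EX : \int[lX]_x x%:E = 'E_P[X] by rewrite unlock integral_distribution.
have EY : \int[lY]_y y%:E = 'E_P[Y] by rewrite unlock integral_distribution.
(* Tonelli: the iterated integral of [|x * y|] factors into the absolute first moments of [X] and
   [Y], both finite. *)
have ih : (lX \x lY).-integrable setT h.
  apply/integrable12ltyP => //.
  rewrite (eq_integral (fun x : R => (\int[lY]_y `|y%:E|) * `|x%:E|)); last first.
    move=> x _; rewrite /h muleC -ge0_integralZl//.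
    - by apply: eq_integral => y _; rewrite EFinM abseM.
    - by apply/measurableT_comp => //; apply/measurable_EFinP.
  rewrite ge0_integralZl//; last 2 first.
  - by apply/measurableT_comp => //; apply/measurable_EFinP.
  - exact: integral_ge0.
  case/integrableP: ilX => _ ilX; case/integrableP: ilY => _ ilY.
  by rewrite lte_mul_pinfty ?integral_ge0// ge0_fin_numE ?integral_ge0.
(* Integrability goes back from the product measure to [P] through the joint law. *)
have iXY : P.-integrable setT (h \o XYw).
  apply/integrableP; split; first exact: measurableT_comp.
  have /integrableP[_] := ih.
  rewrite -(@eq_measure_integral _ _ _ _ _ joint); last first.
    by move=> A mA _; exact: jointE.
  by rewrite ge0_integral_distribution//; exact: measurableT_comp.
split; first exact/Lfun1_integrable.
transitivity (\int[joint]_z h z).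
  by rewrite unlock integral_distribution.
rewrite (@eq_measure_integral _ _ _ _ (lX \x lY)%E); last first.
  by move=> A mA _; exact: jointE.
rewrite -integral12_prod_meas1// /fubini_F -EX.
rewrite -(fineK (expectation_fin_num Y1)) -integralZr//; apply: eq_integral => x _.
by rewrite /h fineK ?expectation_fin_num// -EY -integralZl.
Qed.

End independent_pair.

(** * Cylinder sets and the sigma-algebra generated by a finite subfamily *)

Definition cylinders {T : Type} {d} {V : measurableType d} {I : choiceType}
    (X : I -> T -> V) (J : {fset I}) : set (set T) :=
  [set \bigcap_(l in [set` J]) X l @^-1` B l | B in
    [set B : I -> set V | forall l, l \in J -> measurable (B l)]].

Section cylinders.
Context {d} {T : measurableType d} {R : realType} {I : choiceType}.
Variables (X : I -> T -> R) (J : {fset I}).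

Lemma cylindersT : cylinders X J [set: T].
Proof. by exists (fun=> setT) => //; apply/seteqP. Qed.

Lemma setI_closed_cylinders : setI_closed (cylinders X J).
Proof.
move=> _ _ [B mB <-] [C mC <-]; exists (fun l => B l `&` C l).
  by move=> l lJ; apply: measurableI; [exact: mB|exact: mC].
by rewrite -bigcapI.
Qed.

Lemma cylinders_measurable :
  (forall l, l \in J -> measurable_fun setT (X l)) ->
  cylinders X J `<=` measurable.
Proof.
move=> mX _ [B mB <-]; apply: fin_bigcap_measurable => // l lJ.
by rewrite -[_ @^-1` _]setTI; apply: mX => //; exact: mB.
Qed.

(** Equipping the domain with the sigma-algebra generated by the cylinders expresses measurability
    with respect to sigma([X l], [l] in [J]). *)
Lemma measurable_fun_cylinders l : l \in J ->
  measurable_fun [set: g_sigma_algebraType (cylinders X J)] (X l).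
Proof.
move=> lJ _ B mB; rewrite setTI; apply: sub_sigma_algebra.
(* The preimage of [B] under [X l] is the cylinder with base [B] at [l] and the whole line at every
   other index. *)
exists (fun l' => if l' == l then B else setT) => [l' _|]; first by case: ifP.
apply/seteqP; split => [w|w Bw l' _].
  by move=> /(_ l lJ)/=; rewrite eqxx.
by rewrite /=; case: ifPn => // /eqP ->.
Qed.

End cylinders.

(* The finite measures E |-> P (E & X_a^-1 C) and E |-> P (X_a^-1 C) * P E agree
   on the pi-system of cylinders. *)
Lemma mutually_independent_sigma {d} {T : measurableType d} {R : realType}
    (P : probability T R) (I : choiceType) (A : set I) (X : I -> {RV P >-> R})
    (J : {fset I}) (a : I) (W : T -> R) :
    mutually_independent A X -> [set` J] `<=` A -> A a -> a \notin J ->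
    measurable_fun
      [set: g_sigma_algebraType (cylinders (fun l => X l : T -> R) J)] W ->
  independent_pair P W (X a).
Proof.
move=> indX JA Aa aJ mW B C mB mC.
have mXC : measurable (X a @^-1` C) by exact: measurable_funPTI.
pose m1 := mrestr P mXC.
pose c : {nonneg R} := NngNum (fine_ge0 (measure_ge0 P (X a @^-1` C))).
pose m2 := mscale c P.
have m2E E : m2 E = (P (X a @^-1` C) * P E)%E.
  by rewrite /m2 /mscale/= fineK ?fin_num_measure.
suff : m1 (W @^-1` B) = m2 (W @^-1` B).
  rewrite /m1 /mrestr => ->.
  by rewrite m2E muleC.
(* Both measures are finite, so the constant sequence [setT] serves as the exhausting cover. *)
apply: (g_sigma_algebra_measure_unique
  (cylinders (fun l => X l : T -> R) J) _ (fun=> setT)).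
- by apply: cylinders_measurable => l _; exact: measurable_funPT.
- by move=> _; exact: cylindersT.
- by apply/seteqP; split => // w _; exists 0%N.
- exact: setI_closed_cylinders.
- move=> _ [D mD <-].
  apply: etrans (esym (m2E _)); rewrite /m1 /= /mrestr (indX J D)// muleC.
  (* Independence was used over [J] with the bases [D]; it is now used over [J] with [a] added, the
     base at [a] being [C]. Since [a] is not in [J], the bases on [J] do not change. *)
  pose D' l := if l == a then C else D l.
  have D'a : D' a = C by rewrite /D' eqxx.
  have D'J l : l \in J -> D' l = D l.
    by rewrite /D'; case: eqP => // ->; rewrite (negPf aJ).
  have := indX (a |` J)%fset D'; rewrite big_fsetU1//= D'a.
  rewrite [in X in _ -> X](eq_big_seq (fun l => P (X l @^-1` D' l))); last first.
    by move=> l lJ /=; rewrite D'J.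
  rewrite [in RHS]muleC => <-; first 1 last.
  + by move=> l /=; rewrite !inE => /predU1P[->//|/JA].
  + move=> l; rewrite !inE /D'; case: eqP => [->//|_ /= lJ]; exact: mD.
  congr (P _); apply/seteqP; split => [w [Dw Cw] l/=|w Dw]; last split.
  + rewrite !inE /D'; case: eqP => [->//|_ /= lJ]; exact: Dw.
  + move=> l lJ /=; rewrite -D'J//; apply: Dw => /=.
    by rewrite !inE; apply/orP; right; exact: lJ.
  + by have := Dw a; rewrite D'a; apply => /=; rewrite !inE eqxx.
- by move=> _; rewrite /= ltey_eq fin_num_measure.
- by rewrite -[_ @^-1` _]setTI; exact: (mW measurableT B mB).
Qed.

(** * Random variables with prescribed first and second moments *)

Section moments.
Context {d} {T : measurableType d} {R : realType} (P : probability T R).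

(** Membership in [Lfun P 2%:E] carries the measurability and square integrability that additivity
    of expectation and the variance formula require. *)
Definition has_moments (X : T -> R) (a b : R) : Prop :=
  [/\ X \in Lfun P 2%:E, 'E_P[X] = a%:E & 'E_P[X ^+ 2] = b%:E]%E.

Lemma sqr_Lfun1_Lfun2 (X : T -> R) : measurable_fun setT X ->
  (X ^+ 2) \in Lfun P 1 -> X \in Lfun P 2%:E.
Proof.
move=> mX /Lfun1_integrable/integrableP[_ Xoo].
rewrite inE; apply/andP; split; rewrite inE//=.
rewrite /finite_norm unlock /Lnorm/= poweR_lty//.
apply: le_lt_trans Xoo; rewrite le_eqVlt; apply/orP; left; apply/eqP.
apply: eq_integral => w _ /=.
by rewrite powR_mulrn// -normrX.
Qed.

Lemma Lfun2_sqr_Lfun1 (X : T -> R) : X \in Lfun P 2%:E -> X ^+ 2 \in Lfun P 1.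
Proof. by move=> X2; exact: Lfun2_mul_Lfun1. Qed.

Lemma Lfun2_Lfun1 (X : T -> R) : X \in Lfun P 2%:E -> X \in Lfun P 1.
Proof. by apply: Lfun_subset12; rewrite fin_num_measure. Qed.

Lemma Lfun_measurable (X : T -> R) p : X \in Lfun P p -> measurable_fun setT X.
Proof. by move/sub_Lfun_mfun; rewrite inE. Qed.

Lemma LfunD (p : \bar R) (X Y : T -> R) : (1 <= p)%E ->
  X \in Lfun P p -> Y \in Lfun P p -> X \+ Y \in Lfun P p.
Proof. by move=> p1 Xp Yp; rewrite rpredD. Qed.

Lemma has_moments_variance (X : T -> R) a b : has_moments X a b ->
  'V_P[X] = (b - a ^+ 2)%:E.
Proof. by case=> X2 EX EX2; rewrite varianceE// EX EX2. Qed.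

Lemma has_moments_addr (X : T -> R) a b c : has_moments X a b ->
  has_moments (fun w => X w + c) (a + c) (b + 2 * c * a + c ^+ 2).
Proof.
case=> X2 EX EX2; have X1 := Lfun2_Lfun1 _ X2.
have XX1 := Lfun2_sqr_Lfun1 _ X2.
split.
- by apply: (LfunD _ X (cst c)) => //; [rewrite lee1n|exact: Lfun_cst].
- by rewrite (expectationD X1 (Lfun_cst _ _ _)) EX expectation_cst.
- transitivity ('E_P[(X ^+ 2 \+ ((2 * c) \o* X \+ cst (c ^+ 2)))%R])%E.
    by congr expectation; apply/funext => w; rewrite !fctE/=; ring.
  have cX1 : (2 * c) \o* X \in Lfun P 1 by rewrite Lfun_scale.
  have c1 : cst (c ^+ 2) \in Lfun P 1 := Lfun_cst _ _ _.
  rewrite expectationD ?LfunD// expectationD// expectationZl// EX EX2.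
  by rewrite expectation_cst -!EFinM -!EFinD addrA.
Qed.

(** Squares of independent variables are again independent, so expectation is multiplicative on [X],
    [Y] and on [X ^+ 2], [Y ^+ 2]. The latter also puts [X \* Y] in L^2, where Hölder would give
    only L^1. *)
Lemma has_moments_mul (X Y : T -> R) a b a' b' :
    independent_pair P X Y -> has_moments X a b -> has_moments Y a' b' ->
  has_moments (X \* Y) (a * a') (b * b').
Proof.
move=> XY [X2 EX EX2] [Y2 EY EY2].
have mX := Lfun_measurable _ _ X2; have mY := Lfun_measurable _ _ Y2.
have Lmul (U V : T -> R) : measurable_fun setT U -> measurable_fun setT V ->
    independent_pair P U V -> U \in Lfun P 1 -> V \in Lfun P 1 ->
    (U \* V)%R \in Lfun P 1 /\ ('E_P[(U \* V)%R] = 'E_P[U] * 'E_P[V])%E.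
  move=> mU mV UV.
  pose U' : {RV P >-> R} := HB.pack U (isMeasurableFun.Build _ _ _ _ U mU).
  pose V' : {RV P >-> R} := HB.pack V (isMeasurableFun.Build _ _ _ _ V mV).
  exact: (Lfun1_mul_independent P U' V').
have msqr : measurable_fun [set: R] (fun x : R => x ^+ 2).
  exact: measurable_funX.
have [XY1 EXY] := Lmul _ _ mX mY XY (Lfun2_Lfun1 _ X2) (Lfun2_Lfun1 _ Y2).
have mX2 : measurable_fun setT (X ^+ 2) by exact: (measurable_funX 2 mX).
have mY2 : measurable_fun setT (Y ^+ 2) by exact: (measurable_funX 2 mY).
have XY2 := independent_pair_comp P X Y _ _ msqr msqr XY.
have := Lmul _ _ mX2 mY2 XY2 (Lfun2_sqr_Lfun1 _ X2) (Lfun2_sqr_Lfun1 _ Y2).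
have -> : (X ^+ 2 \* Y ^+ 2 = (X \* Y) ^+ 2)%R.
  by apply/funext => w; rewrite !fctE/= exprMn.
case=> XXYY1 EXXYY; split.
- by apply: sqr_Lfun1_Lfun2 => //; exact: measurable_funM.
- by rewrite EXY EX EY.
- by rewrite EXXYY EX2 EY2.
Qed.

(** Square integrability is recovered from the finite variance: [X - a] is in L^2, and adding back
    the constant [a] stays there. *)
Lemma has_moments_of_variance (X : T -> R) a v : measurable_fun setT X ->
  ('E_P[X] = a%:E)%E -> ('V_P[X] = v%:E)%E -> has_moments X a (v + a ^+ 2).
Proof.
move=> mX EX VX.
have mXa : measurable_fun setT (X \- cst a).
  by apply: measurable_funB => //; exact: measurable_cst.
have Xa2 : (X \- cst a) \in Lfun P 2%:E.
  apply: sqr_Lfun1_Lfun2 => //; apply/Lfun1_integrable/integrableP; split.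
    by apply/measurable_EFinP; exact: (measurable_funX 2 mXa).
  rewrite (eq_integral
    (fun w => (((X \- cst a) * (X \- cst a)) w)%:E)); last first.
    by move=> w _; rewrite !fctE/= ger0_norm ?sqr_ge0.
  by move: VX; rewrite /variance unlock EX/= unlock => ->; rewrite ltry.
have X2 : X \in Lfun P 2%:E.
  have -> : X = (X \- cst a) \+ cst a by apply/funext => w /=; rewrite subrK.
  by apply: LfunD => //; [rewrite lee1n|exact: Lfun_cst].
split => //.
have EX2 := expectation_fin_num (Lfun2_sqr_Lfun1 _ X2).
by move: VX; rewrite varianceE// EX -(fineK EX2) => -[<-]; rewrite subrK.
Qed.

End moments.

(** * Recursions for the moments of the final values *)

Fixpoint mean_rec {R : realType} (u : R) (c : nat -> R) (k : nat) : R :=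
  if k is k'.+1 then u * (mean_rec u c k' + c k) else 0.

Fixpoint sqr_rec {R : realType} (u v : R) (c : nat -> R) (k : nat) : R :=
  if k is k'.+1 then
    v * (sqr_rec u v c k' + 2 * c k * mean_rec u c k' + c k ^+ 2)
  else 0.

(** The dummy value 0 at [k = 0] makes the first year an instance of the general recursion. *)
Lemma final_valueS (R : realType) (i c : nat -> R) k :
  final_value i c k.+1 = (1 + i k.+1) * (final_value i c k + c k.+1).
Proof. by case: k => //=; rewrite add0r. Qed.

Lemma final_value_moments (R : realType) d (T : measurableType d)
    (P : probability T R) (n : nat) (i : nat -> {RV P >-> R}) (u v : R)
    (c : nat -> R) (k : nat) :
    mutually_independent [set l : nat | (1 <= l <= n)%N] i ->
    (forall l, (1 <= l <= n)%N -> has_moments P (fun w => 1 + i l w) u v) ->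
    (k <= n)%N ->
  has_moments P (fun w => final_value (fun l => i l w) c k)
    (mean_rec u c k) (sqr_rec u v c k).
Proof.
move=> indep mom; elim: k => [_|k IH kn].
  split=> /=; first exact: (Lfun_cst _ 0 2).
    exact: expectation_cst.
  rewrite -[RHS](expectation_cst P); congr expectation.
  by apply/funext => w; rewrite !fctE/= expr0n.
(* [J] is the set of years 1 to [k]; it stays fixed while induction on [l] shows that every [C l]
   with [l <= k] is measurable for its sigma-algebra. Year [k.+1] lies outside [J]. *)
pose J := [fset l in iota 1 k]%fset.
pose C l w := final_value (fun l => i l w) c l.
have JE l : (l \in J) = (1 <= l <= k)%N.
  by rewrite !inE mem_iota add1n ltnS.
have mC l : (l <= k)%N -> measurable_fun
    [set: g_sigma_algebraType (cylinders (fun l => i l : T -> R) J)] (C l).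
  elim: l => [_|l IHl lk]; first exact: measurable_cst.
  rewrite (_ : C l.+1 = fun w => (1 + i l.+1 w) * (C l w + c l.+1)); last first.
    by apply/funext => w; rewrite /C final_valueS.
  have mCl := IHl (ltnW lk).
  apply: measurable_funM; last exact: measurable_funD.
  by apply: measurable_funD => //; apply: measurable_fun_cylinders; rewrite JE.
have mCk : measurable_fun
    [set: g_sigma_algebraType (cylinders (fun l => i l : T -> R) J)]
    (fun w => C k w + c k.+1).
  by apply: measurable_funD => //; exact: mC.
have ind : independent_pair P (fun w => C k w + c k.+1) (i k.+1).
  apply: (mutually_independent_sigma P _ _ _ J _ _ indep) => //=.
  - by move=> l /=; rewrite JE => /andP[-> /= /leq_trans]; apply; exact: ltnW.
  - by rewrite JE ltnn andbF.
have mid : measurable_fun [set: R] (id : R -> R) by exact: measurable_id.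
have m1 : measurable_fun [set: R] (fun x : R => 1 + x) by exact: measurable_funD.
have ind1 := independent_pair_comp P _ _ _ _ mid m1 ind.
rewrite (_ : (fun w => _) =
  (fun w => C k w + c k.+1) \* (fun w => 1 + i k.+1 w)).
  rewrite /= [u * _]mulrC [v * _]mulrC.
  apply: has_moments_mul ind1 _ (mom k.+1 kn).
  exact: has_moments_addr (IH (ltnW kn)).
by apply/funext => w; rewrite final_valueS mulrC.
Qed.

(** * Closed forms for geometric payments *)

Section closed_form.
Context {R : realType}.
Implicit Types p q u v x : R.

Lemma s_due_geomS p q x k :
  s_due_geom p q k.+1 x = (1 + x) * (s_due_geom p q k x + p * q ^+ k).
Proof.
rewrite /s_due_geom big_nat_recr//= mulrDr mulr_sumr; congr (_ + _).
  apply: eq_big_nat => l /andP[l1 lk].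
  by rewrite (_ : k.+1 + 1 - l = (k + 1 - l).+1)%N ?exprS; [ring|lia].
by rewrite subn1/= (_ : k.+1 + 1 - k.+1 = 1)%N ?expr1; [ring|lia].
Qed.

Lemma s_due_geom0 p q x : s_due_geom p q 0 x = 0.
Proof. by rewrite /s_due_geom big_geq. Qed.

(** The geometric sum, with the denominator cleared so that no case distinction on [q = 1 + x]
    arises. *)
Lemma s_due_geomE p q x k :
  s_due_geom p q k x * (1 + x - q) = p * (1 + x) * ((1 + x) ^+ k - q ^+ k).
Proof.
elim: k => [|k IH]; first by rewrite s_due_geom0 !expr0; ring.
by rewrite s_due_geomS -mulrA [(_ + _) * (_ - q)]mulrDl IH !exprS; ring.
Qed.

Lemma mean_rec_geom p q x k :
  mean_rec (1 + x) (fun l => p * q ^+ (l - 1)) k = s_due_geom p q k x.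
Proof.
elim: k => [|k IH]; first by rewrite s_due_geom0.
by rewrite s_due_geomS /= IH subn1.
Qed.

(** In the induction step the new terms are, with [m] in closed form, [2 * p q^k * p u (u^k - q^k) +
    (u - q) p^2 q^(2k) = 2 p^2 u^(k+1) q^k - (u + q) p^2 q^(2k)]. These are the increments of the
    two sums on the right, as [u * (1 + r) = 1 + f]. *)
Lemma sqr_rec_geom p q u f r k : u != 0 -> 1 + r = (1 + f) / u ->
  (u - q) * sqr_rec u (1 + f) (fun l => p * q ^+ (l - 1)) k =
  2 * p * u ^+ (k + 1) * s_due_geom p q k r
  - (u + q) * s_due_geom (p ^+ 2) (q ^+ 2) k f.
Proof.
move=> u0 hr; elim: k => [|k IH]; first by rewrite /= !s_due_geom0; ring.
(* The rate [u - 1] has growth factor [u]. *)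
have hm := s_due_geomE p q (u - 1) k.
have ue : 1 + (u - 1) = u by ring.
rewrite -mean_rec_geom ue in hm.
rewrite !s_due_geomS /= subn1/= -!exprM [(2 * k)%N]mulnC.
set m := mean_rec _ _ _ in hm *.
set M := sqr_rec _ _ _ _ in IH *.
transitivity ((1 + f) * ((u - q) * M + 2 * (p * q ^+ k) * (m * (u - q))
   + (u - q) * (p * q ^+ k) ^+ 2)); first by ring.
rewrite IH hm hr exprM !addn1 [u ^+ k.+2]exprS [u ^+ k.+1]exprS.
by field.
Qed.

End closed_form.

Theorem theorem3p2 (R : realType) (d : measure_display) (T : measurableType d)
    (P : probability T R) (n : nat) (i : nat -> {RV P >-> R})
    (j s f r p q : R) (k : nat)
    (hn : (1 <= n)%N)
    (hindep : mutually_independent [set l : nat | (1 <= l <= n)%N] i)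
    (hE : forall l : nat, (1 <= l <= n)%N ->
      ('E_P[(fun w : T => 1 + i l w)%R] = (1 + j)%:E)%E)
    (hV : forall l : nat, (1 <= l <= n)%N ->
      ('V_P[(fun w : T => 1 + i l w)%R] = (s ^+ 2)%:E)%E)
    (hj : j != -1)
    (hf : f = 2 * j + j ^+ 2 + s ^+ 2)
    (hr : 1 + r = (1 + f) / (1 + j))
    (hk : (1 <= k <= n)%N)
    (hp : 0 < p) (hq : 0 < q) (hqj : q != 1 + j) :
  ('V_P[(fun w : T =>
          final_value (fun l => i l w) (fun l => p * q ^+ (l - 1)) k)%R] =
   ((2 * p * (1 + j) ^+ (k + 1) * s_due_geom p q k r
      - (1 + j + q) * s_due_geom (p ^+ 2) (q ^+ 2) k f) / (1 + j - q)
    - p * (1 + j) * (s_due_geom p q (2 * k) j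
                      - 2 * q ^+ k * s_due_geom p q k j) / (1 + j - q))%:E)%E.
Proof.
have u0 : 1 + j != 0 by rewrite addrC addr_eq0.
have uq : 1 + j - q != 0 by rewrite subr_eq0 eq_sym.
have mom l : (1 <= l <= n)%N ->
    has_moments P (fun w => 1 + i l w) (1 + j) (1 + f).
  move=> ln; rewrite (_ : 1 + f = s ^+ 2 + (1 + j) ^+ 2); last by rewrite hf; ring.
  apply: has_moments_of_variance; [|exact: hE|exact: hV].
  exact: measurable_funD.
have /andP[_ kn] := hk.
have /has_moments_variance-> := final_value_moments _ _ _ _ _ _ _ _
  (fun l => p * q ^+ (l - 1)) _ hindep mom kn.
(* The first fraction of the statement is the second moment, its numerator being [(1 + j - q)] times
   it. *)
rewrite -(sqr_rec_geom p q (1 + j) f r k u0 hr) mean_rec_geom.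
set M := sqr_rec _ _ _ _; congr (_%:E).
(* The second fraction is the squared mean: with [u = 1 + j], [u^(2k) - q^(2k) - 2 q^k (u^k - q^k) =
   (u^k - q^k)^2]. *)
have h1 := s_due_geomE p q j k; have h2 := s_due_geomE p q j (2 * k).
have -> : s_due_geom p q k j =
  p * (1 + j) * ((1 + j) ^+ k - q ^+ k) / (1 + j - q) by rewrite -h1 mulfK.
have -> : s_due_geom p q (2 * k) j =
  p * (1 + j) * ((1 + j) ^+ (2 * k) - q ^+ (2 * k)) / (1 + j - q).
  by rewrite -h2 mulfK.
rewrite !(mulnC 2) !exprM.
by field.
Qed.
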